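(* Let $f\in\mathcal S^1_{\mu,L}$ with $0\leqslant\mu\leqslant L<\infty$, $L>0$, and let $x^*$ be a global minimizer of $f$. Let $x_0,v_0\in V$, $\gamma_0=rL\geqslant\mu$ with $\gamma_0>0$, and $y_0=x_0-\frac1L\nabla f(x_0)$. For $k=0,1,\dots$ define $$\alpha_k=\frac{\gamma_k+\sqrt{\gamma_k^2+8L\gamma_k}}{2L},\qquad x_{k+1}=\frac{y_k+\alpha_kv_k}{1+\alpha_k},\qquad y_{k+1}=x_{k+1}-\frac1L\nabla f(x_{k+1}),$$ $$v_{k+1}=\frac{\gamma_kv_k+\mu\alpha_kx_{k+1}}{\gamma_k+\mu\alpha_k}+\frac{L\alpha_k}{\gamma_k+\mu\alpha_k}(y_{k+1}-x_{k+1}),\qquad \gamma_{k+1}=\frac{\gamma_k+\mu\alpha_k}{1+\alpha_k}.$$ Let $\mathcal L_0=f(x_0)-f(x^* )+\frac{\gamma_0}2\|v_0-x^*\|^2$ and $\rho_0=1$, $\rho_k=\prod_{i=0}^{k-1}\frac1{1+\alpha_i}$ for $k\geqslant 1$. Then $$f(y_k)-f(x^* )+\frac{\gamma_k}2\|v_k-x^*\|^2\leqslant\rho_k\mathcal L_0\qquad\forall\,k\geqslant 0,$$ and $$\rho_k\leqslant\min\left\{\left(\frac{\sqrt2}{\sqrt2+\sqrt r\,k}\right)^2,\ \left(1+\sqrt{\frac{2\mu}L}\right)^{-k}\right\}.$$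
   Context: $V$ is a real Hilbert space with norm $\|\cdot\|$, identified with its dual by the Riesz map (so gradients are elements of $V$); $\langle\cdot,\cdot\rangle$ is the pairing. $\mathcal S^1_{\mu,L}$ is the set of convex continuously differentiable $f:V\to\mathbb R$ with $\mu\|x-y\|^2\leqslant\langle\nabla f(x)-\nabla f(y),x-y\rangle\leqslant L\|x-y\|^2$ for all $x,y\in V$. Existence of a global minimizer is a standing assumption. *)

(* Defs.v *)
From HB Require Import structures.
From mathcomp Require Import all_boot all_order all_algebra sesquilinear.
From mathcomp Require Import all_classical all_reals all_analysis.
From mathcomp Require Import ring lra.

Set Implicit Arguments.
Unset Strict Implicit.
Unset Printing Implicit Defensive.

Import Order.TTheory GRing.Theory Num.Theory.
Import numFieldNormedType.Exports.

Local Open Scope classical_set_scope.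
Local Open Scope ring_scope.

(* A real Hilbert space is a complete normed space [V] together with an inner
   product [dot] inducing its norm. *)
Definition induces_norm (R : realType) (V : normedModType R)
    (dot : {dot V for (@idfun R)}) : Prop :=
  forall x : V, `|x| = Num.sqrt (dot x x).

(* The Riesz representative of the differential; see [gradP]. *)
Definition grad (R : realType) (V : normedModType R)
    (dot : {dot V for (@idfun R)}) (f : V -> R^o) (x : V) : V :=
  xget 0 [set g | forall h : V, 'd f x h = dot g h].

Section Riesz.
Context (R : realType) (V : completeNormedModType R).
Context (dot : {dot V for (@idfun R)}) (hdot : induces_norm dot).

Lemma dotC (x y : V) : dot x y = dot y x.
Proof. by rewrite hermC expr0 mul1r. Qed.

Lemma dotZl (t : R) (x y : V) : dot (t *: x) y = t * dot x y.
Proof. exact: linearZl_LR. Qed.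

Lemma dotZr (t : R) (x y : V) : dot x (t *: y) = t * dot x y.
Proof. by rewrite dotC dotZl dotC. Qed.

Lemma dotDl (x y z : V) : dot (x + y) z = dot x z + dot y z.
Proof. exact: linearDl. Qed.

Lemma dotDr (x y z : V) : dot z (x + y) = dot z x + dot z y.
Proof. exact: linearDr. Qed.

Lemma dotNl (x y : V) : dot (- x) y = - dot x y.
Proof. exact: linearNl. Qed.

Lemma dotNr (x y : V) : dot y (- x) = - dot y x.
Proof. exact: linearNr. Qed.

Lemma dotxx_ge0 (x : V) : 0 <= dot x x.
Proof.
have [->|x0] := eqVneq x 0; first by rewrite linear0l.
by apply: ltW; exact: neq0_dnorm_gt0.
Qed.

Lemma dotxx (x : V) : dot x x = `|x| ^+ 2.
Proof. by rewrite hdot sqr_sqrtr// dotxx_ge0. Qed.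

Theorem riesz (l : {linear V -> R^o}) : continuous l ->
  exists g : V, forall h, l h = dot g h.
Proof.
move=> cl.
have lD x y : l (x + y) = l x + l y by exact: linearD.
have lZ t x : l (t *: x) = t * l x by exact: linearZ.
have [M M0 lM] : exists2 M : R, 0 < M & forall x, `|l x| <= M * `|x|.
  have /linear_boundedP[M [Mr HM]] := continuous_linear_bounded 0 (cl 0).
  exists (`|M| + 1); first by rewrite ltr_wpDl.
  by apply: HM; rewrite (le_lt_trans (ler_norm M))// ltrDl.
pose phi x := `|x| ^+ 2 - 2 * l x.
have phi_ge x : - M ^+ 2 <= phi x.
  have := ler_norm (l x); have := lM x; rewrite /phi; set a := `|x|.
  have : 0 <= (a - M) ^+ 2 by exact: sqr_ge0.
  by rewrite sqrrB; nra.
pose m := inf (range phi).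
have hlb : has_lbound (range phi) by exists (- M ^+ 2) => _ [x _ <-].
have m_le x : m <= phi x by apply: ge_inf => //; exists x.
have hinf : has_inf (range phi) by split => //; exists (phi 0); exists 0.
have mid x y : `|x - y| ^+ 2 <= 2 * (phi x - m) + 2 * (phi y - m).
  have := m_le (2^-1 *: (x + y)); rewrite /phi -!dotxx lZ lD.
  rewrite dotZl dotZr !(dotDl, dotDr, dotNl, dotNr) (dotC y x).
  by lra.
pose A e := [set x | phi x < m + e].
pose F := filter_from [set e : R | 0 < e] A.
have FF : ProperFilter F.
  apply: filter_from_proper; last first.
    move=> e e0; have [_ [x _ <-] xe] := inf_adherent e0 hinf.
    by exists x.
  apply: filter_from_filter; first by exists 1; rewrite /= ltr01.
  move=> e1 e2 /= e10 e20; exists (Num.min e1 e2); first by rewrite /= lt_min e10.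
  move=> x; rewrite /A /= => xe; split; apply: (lt_le_trans xe);
    by rewrite lerD2l ge_min lexx ?orbT.
have cF : cvg F.
  apply/cauchy_cvgP/cauchy_exP => e e0.
  have d0 : 0 < e ^+ 2 / 4 by rewrite divr_gt0// exprn_gt0.
  have [_ [x _ <-] xe] := inf_adherent d0 hinf.
  exists x; exists (e ^+ 2 / 4) => // y; rewrite /A /= -ball_normE /= => ye.
  rewrite -(@ltr_pXn2r _ 2)// ?nnegrE ?normr_ge0 ?ltW//.
  by apply: le_lt_trans (mid x y) _; rewrite -/m in xe; lra.
pose g : V := lim F.
have phic : continuous phi.
  move=> x; rewrite /phi; apply: cvgB.
    by under eq_fun do rewrite expr2; apply: cvgM; exact: norm_continuous.
  by apply: cvgM; [exact: cvg_cst|exact: cl].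
have phig : phi g = m.
  apply/eqP; rewrite eq_le m_le andbT; apply/ler_addgt0Pr => e e0.
  have phiF : phi x @[x --> F] --> phi g by apply: cvg_comp; [exact: cF|exact: phic].
  apply: (closed_cvg (fun z => z <= m + e) _ _ _ phiF).
    exact: closed_le.
  by exists e => // x /= /ltW.
exists g => h.
have quad t : 0 <= t ^+ 2 * dot h h + 2 * t * (dot g h - l h).
  have := m_le (g + t *: h); rewrite -phig /phi -!dotxx lD lZ.
  rewrite !(dotDl, dotDr) !(dotZl, dotZr) (dotC h g).
  by lra.
apply/eqP; rewrite eq_sym -subr_eq0; set d := _ - _ in quad *.
apply/eqP; have := dotxx_ge0 h; set q := dot h h in quad * => q0.
have := quad (- d / (q + 1)).
have q1 : 0 < q + 1 by lra.
have -> : (- d / (q + 1)) ^+ 2 * q + 2 * (- d / (q + 1)) * d =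
   - (d ^+ 2 * (q + 2)) / (q + 1) ^+ 2 by field; lra.
rewrite ler_pdivlMr ?exprn_gt0// mul0r oppr_ge0 => H.
apply/eqP; rewrite -sqrf_eq0 eq_le sqr_ge0 andbT.
by rewrite -(@pmulr_lle0 _ (q + 2))//; lra.
Qed.

Lemma gradP (f : V -> R^o) (x h : V) :
  differentiable f x -> 'd f x h = dot (grad dot f x) h.
Proof.
move=> /diff_continuous /riesz[g hg].
by rewrite /grad; case: xgetP => [_ -> ->//|/(_ g)].
Qed.

End Riesz.

Record S1 (R : realType) (V : normedModType R)
    (dot : {dot V for (@idfun R)}) (mu L : R) (f : V -> R^o) : Prop := {
  S1_convex : convex_function [set: V] f;
  S1_differentiable : forall x : V, differentiable f x;
  S1_continuous_grad : continuous (grad dot f);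
  S1_lower : forall x y : V,
    mu * `|x - y| ^+ 2 <= dot (grad dot f x - grad dot f y) (x - y);
  S1_upper : forall x y : V,
    dot (grad dot f x - grad dot f y) (x - y) <= L * `|x - y| ^+ 2 }.

(* Main.v *)
Require Import Defs.
From mathcomp Require Import all_boot all_order all_algebra sesquilinear.
From mathcomp Require Import all_classical all_reals all_analysis.
From mathcomp Require Import ring lra.

Set Implicit Arguments.
Unset Strict Implicit.
Unset Printing Implicit Defensive.

Import Order.TTheory GRing.Theory Num.Theory.
Import numFieldNormedType.Exports.

Local Open Scope classical_set_scope.
Local Open Scope ring_scope.

(** Since f (y k) <= f (x k) - |grad f (x k)|^2 / (2 L), it suffices to bound
    E_k = f (x k) - |grad f (x k)|^2 / (2 L) - f xs + gamma_k / 2 |v k - xs|^2,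
    and (1 + alpha_k) E_(k+1) <= E_k is the sum of the cocoercivity inequality
    between x k and x (k+1), alpha_k times strong convexity between x (k+1) and
    xs, and a nonnegative multiple of
    |gamma_k (v k - x (k+1)) - alpha_k grad f (x (k+1))|^2; the terms cancel
    because L alpha_k^2 = gamma_k (2 + alpha_k).
    For the rates, gamma_k >= mu gives alpha_k^2 >= 2 mu / L, while
    gamma_k >= gamma_0 rho_k makes 1 / sqrt rho_k grow by at least sqrt (r / 2)
    at each step. *)

(* dd, du, ... stand for the inner products of d = v - x, u = x - xs and the
   gradient g at x, and F0 for f z - |grad f z|^2 / (2 L), where z is the
   previous iterate. *)
Lemma lyapunov_certificate (R : realFieldType)
    (mu L alpha gam c F F0 Fs dd du dg uu ug gg : R) :
  0 < L -> 0 <= mu -> 0 < alpha -> 0 < gam ->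
  L * alpha ^+ 2 = gam * (2 + alpha) -> c = gam + mu * alpha ->
  F - alpha * dg + gg / (2 * L) <= F0 ->
  F - ug + mu / 2 * uu <= Fs ->
  0 <= gam ^+ 2 * dd - 2 * gam * alpha * dg + alpha ^+ 2 * gg ->
  (1 + alpha) * (F - gg / (2 * L) - Fs) +
    c / 2 * (c^-1 ^+ 2 *
      (gam ^+ 2 * dd - 2 * gam * alpha * dg + alpha ^+ 2 * gg)
      + 2 * c^-1 * (gam * du - alpha * ug) + uu) <=
  F0 - Fs + gam / 2 * (dd + 2 * du + uu).
Proof.
move=> L0 mu0 a0 g0 aE cE C S N.
have c0 : 0 < c by rewrite cE ltr_pwDl// mulr_ge0// ltW.
(* The weight [mu * alpha / (2 * c * gam)] is forced by the coefficient of [dd], which is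
   [gam / 2 - gam ^+ 2 / (2 * c)] in the difference of the two sides. *)
have {}N := mulr_ge0 (divr_ge0 (mulr_ge0 mu0 (ltW a0))
  (ltW (mulr_gt0 (mulr_gt0 (ltr0n _ 2) c0) g0))) N.
rewrite -subr_ge0 in C; rewrite -subr_ge0 in S; rewrite -subr_ge0.
have {}S := mulr_ge0 (ltW a0) S.
have := addr_ge0 (addr_ge0 C S) N; congr (0 <= _).
(* Solving the step size equation for [gam] keeps everything rational in [alpha], so [field] can
   check the identity. *)
have gE : gam = L * alpha ^+ 2 / (2 + alpha).
  by rewrite aE mulfK// lt0r_neq0// addr_gt0.
have a2 : 0 < 2 + alpha by rewrite addr_gt0.
rewrite cE gE; field.
have s0 := mulr_ge0 (mulr_ge0 mu0 (ltW a0)) (ltW a2).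
by rewrite !lt0r_neq0// ltr_pwDl// mulr_gt0// exprn_gt0.
Qed.

(** * Quadratic bounds, cocoercivity and the one-step energy decrease *)

Section SmoothConvex.
Context (R : realType) (V : completeNormedModType R).
Context (dot : {dot V for (@idfun R)}) (hdot : induces_norm dot).
Context (mu L : R) (hL : 0 < L) (f : V -> R^o) (hf : S1 dot mu L f).

Let G := grad dot f.

Lemma is_derive_line (x h : V) (t : R) :
  is_derive t (1 : R) (fun s : R => f (x + s *: h)) (dot (G (x + t *: h)) h).
Proof.
have dl : is_diff t (fun s : R => x + s *: h) (fun s : R => s *: h).
  by apply: is_diff_eq; rewrite add0r.
have df := S1_differentiable hf (x + t *: h).
have dfl : differentiable (f \o (fun s : R => x + s *: h)) t.
  by apply: differentiable_comp.
apply: DeriveDef; first exact: diff_derivable.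
rewrite deriveE// diff_comp//= diff_val /= scale1r.
exact: gradP.
Qed.

(** Mean value theorem for the remainder along the segment from [x] to [x + h], with
    [z = x + c *: h]. As [c] is positive, the sign of the right side decides that of the remainder:
    [K = L] gives the upper quadratic bound and [K = mu] the lower one. *)
Lemma taylor_gap (K : R) (x h : V) : exists c, exists2 z, 0 < c &
  c * ((f (x + h) : R) - ((f x : R) + dot (G x) h + K / 2 * `|h| ^+ 2)) =
  dot (G z - G x) (z - x) - K * `|z - x| ^+ 2.
Proof.
pose phi (t : R) := (f (x + t *: h) : R) - t * dot (G x) h
  - t ^+ 2 * (K / 2 * `|h| ^+ 2).
pose dphi (t : R) := dot (G (x + t *: h)) h - dot (G x) h
  - t * K * `|h| ^+ 2.
have dphiP (t : R) : is_derive t (1 : R) phi (dphi t).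
  have d := is_derive_line x h t.
  apply: is_derive_eq.
  have E (a b n : R) : a - (t * 0 + b * 1) -
      (t ^+ 2 * 0 + (K / 2 * n) * (t * 1 + t * 1)) = a - b - t * K * n.
    by field.
  exact: E.
have [||c c01 E] := @MVT R phi dphi 0 1.
- exact: ltr01.
- apply: derivable_within_continuous => t _; apply: ex_derive.
move: c01; rewrite in_itv /= => /andP[c0 _].
exists c, (x + c *: h) => //; move: E; rewrite /phi /dphi scale1r scale0r addr0.
rewrite (addrC x (c *: h)) addrK -!(dotxx hdot) !dotZr dotZl dotDl dotNl.
have E (a b d e n : R) :
    a - 1 * d - 1 ^+ 2 * (K / 2 * n) - (b - 0 * d - 0 ^+ 2 * (K / 2 * n)) =
      (e - d - c * K * n) * (1 - 0) ->
    c * (a - (b + d + K / 2 * n)) = c * (e - d) - K * (c * (c * n)).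
  move=> H; transitivity (c * ((e - d - c * K * n) * (1 - 0))); last by ring.
  by rewrite -H; ring.
exact: E.
Qed.

Lemma S1_descent (x h : V) :
  (f (x + h) : R) <= (f x : R) + dot (G x) h + L / 2 * `|h| ^+ 2.
Proof.
have [c [z c0 E]] := taylor_gap L x h.
by rewrite -subr_le0 -(pmulr_rle0 _ c0) E subr_le0 (S1_upper hf).
Qed.

Lemma S1_strong_convexity (x h : V) :
  (f x : R) + dot (G x) h + mu / 2 * `|h| ^+ 2 <= (f (x + h) : R).
Proof.
have [c [z c0 E]] := taylor_gap mu x h.
by rewrite -subr_ge0 -(pmulr_rge0 _ c0) E subr_ge0 (S1_lower hf).
Qed.

Lemma S1_gradient_step (x : V) :
  (f (x - L^-1 *: G x) : R) <= (f x : R) - `|G x| ^+ 2 / (2 * L).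
Proof.
apply: le_trans (S1_descent _ _) _; rewrite -!(dotxx hdot).
rewrite !(dotNl, dotNr, dotZl, dotZr) -addrA lerD2l.
have E (n : R) : - (L^-1 * n) + L / 2 * - - (L^-1 * (L^-1 * n)) =
    - (n / (2 * L)).
  by field; exact: lt0r_neq0.
by rewrite E.
Qed.

Context (hmu : 0 <= mu).

(* Compare f at z - (G z - G x) / L with its tangent at x and its upper
   quadratic model at z. *)
Lemma S1_cocoercive (x z : V) :
  (f x : R) + dot (G x) (z - x) + `|G z - G x| ^+ 2 / (2 * L) <= (f z : R).
Proof.
have U := S1_descent z (- (L^-1 *: (G z - G x))).
have := S1_strong_convexity x (z - L^-1 *: (G z - G x) - x).
rewrite (addrC x) subrK => W.
have N : 0 <= mu / 2 * `|z - L^-1 *: (G z - G x) - x| ^+ 2.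
  by rewrite mulr_ge0 ?divr_ge0 ?sqr_ge0.
have {}W := le_trans (lerD (lexx _) N) W; rewrite addr0 in W.
have := le_trans W U; rewrite -!(dotxx hdot); move: (G x) (G z) => g g'.
rewrite !(dotDl, dotDr, dotNl, dotNr, dotZl, dotZr) (dotC dot g g').
have A (a b zz zx xx xz' xx' : R) :
    a + (xz' - L^-1 * (zx - xx) - xx') <=
    b - L^-1 * (zz - zx) + L / 2 *
      - - (L^-1 * (L^-1 * (zz - zx) - L^-1 * (zx - xx))) ->
    a + (xz' - xx') + (zz - zx + (- zx - - xx)) / (2 * L) <= b.
  rewrite -subr_ge0 -[in X in _ -> X]subr_ge0; congr (0 <= _).
  by field; exact: lt0r_neq0.
exact: A.
Qed.

(** Here [z], [v] are the iterates at step [k] and [x], [v'] those at step [k.+1]. Expanding all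
    inner products reduces the claim to [lyapunov_certificate]. *)
Lemma lyapunov_step (x z v v' xs : V) (alpha gam : R) :
  0 < alpha -> 0 < gam -> L * alpha ^+ 2 = gam * (2 + alpha) ->
  (1 + alpha) *: x = z - L^-1 *: G z + alpha *: v ->
  v' = x + (gam + mu * alpha)^-1 *: (gam *: (v - x) - alpha *: G x) ->
  (1 + alpha) * ((f x : R) - `|G x| ^+ 2 / (2 * L) - f xs) +
    (gam + mu * alpha) / 2 * `|v' - xs| ^+ 2 <=
  (f z : R) - `|G z| ^+ 2 / (2 * L) - f xs + gam / 2 * `|v - xs| ^+ 2.
Proof.
move=> a0 g0 aE xE ->.
have C := S1_cocoercive x z.
have S := S1_strong_convexity x (xs - x).
rewrite (addrC x) subrK in S.
have zxE : z - x = L^-1 *: G z - alpha *: (v - x).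
  have zE : z = x + alpha *: x - alpha *: v + L^-1 *: G z.
    by rewrite -{1}[x]scale1r -scalerDl xE addrK subrK.
  by rewrite {1}zE scalerBr opprB addrC !addrA addNr add0r addrC addrA.
have -> : v - xs = (v - x) + (x - xs) by rewrite addrA subrK.
rewrite (addrAC x) addrC.
move: C S; rewrite zxE -(opprB x xs).
set c := gam + mu * alpha.
move: (v - x) (x - xs) (G x) (G z) => d u g g'.
have := dotxx_ge0 dot (gam *: d - alpha *: g).
rewrite -!(dotxx hdot) !(dotDl, dotDr, dotNl, dotNr, dotZl, dotZr).
rewrite (dotC dot g' g) (dotC dot g d) (dotC dot u d) (dotC dot u g).
move: (dot d d) (dot d u) (dot d g) (dot u u) (dot g u) (dot g g)
  (dot g g') (dot g' g') => dd du dg uu ug gg gg' g'g'.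
move: (f x : R) (f z : R) (f xs : R) => F Fz Fs N C S.
have := @lyapunov_certificate R mu L alpha gam c F (Fz - g'g' / (2 * L)) Fs
  dd du dg uu ug gg hL hmu a0 g0 aE erefl.
(* The product [gg'] coming from [z - x] cancels the cross term of the squared gradient
   difference. *)
have -> : F - alpha * dg + gg / (2 * L) <= Fz - g'g' / (2 * L).
  rewrite -subr_ge0; move: C; rewrite -subr_ge0; congr (0 <= _).
  by field; exact: lt0r_neq0.
have -> : F - ug + mu / 2 * uu <= Fs by move: S; rewrite opprK.
have -> : 0 <= gam ^+ 2 * dd - 2 * gam * alpha * dg + alpha ^+ 2 * gg.
  by move: N; congr (0 <= _); ring.
move=> /(_ isT isT isT).
by rewrite -subr_ge0 -[in X in _ -> X]subr_ge0; congr (0 <= _); ring.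
Qed.
End SmoothConvex.

(** The formula is the positive root of [L * a ^+ 2 - gam * a - 2 * gam]. *)
Lemma step_size_quadratic (R : rcfType) (L gam a : R) :
  0 < L -> 0 < gam ->
  a = (gam + Num.sqrt (gam ^+ 2 + 8%:R * L * gam)) / (2%:R * L) ->
  0 < a /\ L * a ^+ 2 = gam * (2 + a).
Proof.
move=> L0 g0; set q := gam ^+ 2 + _ => aE.
have q0 : 0 < q by rewrite /q ltr_pwDl ?exprn_gt0// !mulr_ge0// ltW.
have := sqr_sqrtr (ltW q0); have := sqrtr_ge0 q.
move: (Num.sqrt q) aE => t -> t0 tE; split.
  by rewrite divr_gt0 ?mulr_gt0// ltr_pwDl.
have -> : L * ((gam + t) / (2%:R * L)) ^+ 2 =
    (gam ^+ 2 + 2 * gam * t + t ^+ 2) / (4 * L).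
  by field; exact: lt0r_neq0.
by rewrite tE /q; field; exact: lt0r_neq0.
Qed.

(** With [s] the inverse square root of [rho k] and [a = alpha k], the product
    [s * (Num.sqrt (1 + a) - 1)] is the increment of [s] in one step. *)
Lemma sqrt_rate_step (R : rcfType) (r a s : R) :
  0 <= r -> 0 < a -> 0 <= s -> r * (2 + a) <= a ^+ 2 * s ^+ 2 ->
  Num.sqrt r <= Num.sqrt 2 * s * (Num.sqrt (1 + a) - 1).
Proof.
move=> r0 a0 s0 H.
have := sqr_sqrtr (ltW (addr_gt0 ltr01 a0)).
have q1 : 1 <= Num.sqrt (1 + a) by rewrite -[1 in leLHS]sqrtr1 ler_sqrt; lra.
move: (Num.sqrt (1 + a)) q1 => q q1 qE.
have ? : 0 <= s * (q - 1) by rewrite mulr_ge0// subr_ge0.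
rewrite -mulrA -(ler_pXn2r (n := 2)) ?nnegrE ?mulr_ge0 ?sqrtr_ge0 ?subr_ge0//.
rewrite (sqr_sqrtr r0) exprMn sqr_sqrtr//.
(* This factor turns [q - 1] into [q ^+ 2 - 1 = a]; on the other side it is at most
   [2 * (1 + q ^+ 2) = 2 * (2 + a)]. *)
rewrite -(ler_pM2r (x := (1 + q) ^+ 2)); last first.
  by rewrite exprn_gt0//; lra.
have -> : 2 * (s * (q - 1)) ^+ 2 * (1 + q) ^+ 2 =
    2 * ((q ^+ 2 - 1) ^+ 2 * s ^+ 2).
  by ring.
have -> : q ^+ 2 - 1 = a by rewrite qE; ring.
have : r * (1 + q) ^+ 2 <= r * (2 * (2 + a)).
  apply: ler_wpM2l => //; have aq : a = q ^+ 2 - 1 by rewrite qE; ring.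
  by have := sqr_ge0 (q - 1); rewrite aq; lra.
lra.
Qed.

(** * Bounds on [gamma] and the two decay rates of [rho] *)

Section Rates.
Context (R : rcfType) (mu L : R) (hmu : 0 <= mu) (hL : 0 < L).
Context (alpha gamma rho : nat -> R).
Context (hgamma0mu : mu <= gamma 0%N) (hgamma0_gt0 : 0 < gamma 0%N).
Context (halpha : forall k, alpha k =
  (gamma k + Num.sqrt (gamma k ^+ 2 + 8%:R * L * gamma k)) / (2%:R * L)).
Context (hgamma : forall k,
  gamma k.+1 = (gamma k + mu * alpha k) / (1 + alpha k)).
Context (hrho : forall k, rho k = \prod_(i < k) (1 + alpha i)^-1).

Lemma gamma_gt0 k : 0 < gamma k.
Proof.
elim: k => // k IH; have [a0 _] := step_size_quadratic hL IH (halpha k).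
by rewrite hgamma divr_gt0 ?(addr_gt0 ltr01 a0)// ltr_pwDl// mulr_ge0// ltW.
Qed.

Lemma alphaP k :
  0 < alpha k /\ L * alpha k ^+ 2 = gamma k * (2 + alpha k).
Proof. exact: step_size_quadratic hL (gamma_gt0 k) (halpha k). Qed.

Lemma rhoS k : rho k.+1 = rho k / (1 + alpha k).
Proof. by rewrite !hrho big_ord_recr. Qed.

Lemma rho_gt0 k : 0 < rho k.
Proof.
rewrite hrho prodr_gt0// => i _; have [a0 _] := alphaP i.
by rewrite invr_gt0 addr_gt0.
Qed.

(** Each new [gamma] is the average of the old one and [mu] with weights proportional to 1 and
    [alpha k]. *)
Lemma gamma_ge_mu k : mu <= gamma k.
Proof.
elim: k => // k IH; have [a0 _] := alphaP k.
by rewrite hgamma ler_pdivlMr ?addr_gt0// mulrDr mulr1 lerD2r.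
Qed.

(** Without the term [mu * alpha k], the recursion of [gamma] is that of [rho]. *)
Lemma gamma_ge_rho k : gamma 0%N * rho k <= gamma k.
Proof.
elim: k => [|k IH]; first by rewrite hrho big_ord0 mulr1.
have [a0 _] := alphaP k.
rewrite rhoS hgamma mulrA ler_pM2r ?invr_gt0 ?addr_gt0//.
by rewrite (le_trans IH)// lerDl mulr_ge0// ltW.
Qed.

Lemma rho_linear k : rho k <= (1 + Num.sqrt (2%:R * mu / L)) ^- k.
Proof.
elim: k => [|k IH]; first by rewrite hrho big_ord0 expr0 invr1.
have [a0 aE] := alphaP k; have q0 := sqrtr_ge0 (2%:R * mu / L).
have q1 : 0 < 1 + Num.sqrt (2%:R * mu / L) by rewrite ltr_pwDl.
rewrite rhoS exprS invfM mulrC; apply: ler_pM => //.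
- by rewrite invr_ge0 addr_ge0// ltW.
- exact/ltW/rho_gt0.
rewrite lef_pV2 ?posrE ?(addr_gt0 ltr01 a0)// lerD2l.
rewrite -(ler_pXn2r (n := 2)) ?nnegrE ?(ltW a0)//.
rewrite sqr_sqrtr; last by rewrite divr_ge0 ?(ltW hL)// mulr_ge0.
rewrite ler_pdivrMr// [leRHS]mulrC aE mulrC.
by apply: ler_pM => //; [exact: gamma_ge_mu|rewrite lerDl ltW].
Qed.

Lemma rho_quadratic r k : gamma 0%N = r * L ->
  rho k <= (Num.sqrt 2%:R / (Num.sqrt 2%:R + Num.sqrt r * k%:R)) ^+ 2.
Proof.
move=> rE.
have r0 : 0 <= r.
  by rewrite -(pmulr_lge0 _ hL) -rE ltW.
have t0 : 0 < Num.sqrt 2 :> R by rewrite sqrtr_gt0.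
have d0 : 0 < Num.sqrt 2 + Num.sqrt r * k%:R.
  by rewrite ltr_pwDl// mulr_ge0// sqrtr_ge0.
(* Inverting and taking roots makes the bound linear in [k], hence provable by adding [Num.sqrt r]
   at each step. *)
suff H : Num.sqrt 2 + Num.sqrt r * k%:R <= Num.sqrt 2 * Num.sqrt (rho k)^-1.
  rewrite -[leLHS]invrK -invf_div exprVn.
  rewrite lef_pV2 ?posrE ?exprn_gt0 ?invr_gt0 ?rho_gt0 ?divr_gt0//.
  rewrite -[leRHS]sqr_sqrtr; last by rewrite invr_ge0 ltW// rho_gt0.
  rewrite ler_pXn2r ?nnegrE ?sqrtr_ge0 ?divr_ge0 ?(ltW t0) ?(ltW d0)//.
  by rewrite ler_pdivrMr// [leRHS]mulrC.
elim: k {d0} => [|k IH].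
  by rewrite hrho big_ord0 invr1 sqrtr1 mulr0 mulr1 addr0.
have [a0 aE] := alphaP k.
have ri0 : 0 <= (rho k)^-1 by rewrite invr_ge0 ltW// rho_gt0.
have H : r * (2 + alpha k) <= alpha k ^+ 2 * Num.sqrt (rho k)^-1 ^+ 2.
  rewrite sqr_sqrtr// ler_pdivlMr ?rho_gt0// -(ler_pM2l hL) aE.
  have -> : L * (r * (2 + alpha k) * rho k) =
    gamma 0%N * rho k * (2 + alpha k) by rewrite rE; ring.
  by rewrite ler_pM2r ?addr_gt0// gamma_ge_rho.
have := sqrt_rate_step r0 a0 (sqrtr_ge0 _) H.
rewrite rhoS invf_div [_ / rho k]mulrC sqrtrM// -[k.+1%:R]natr1.
have E (t s q : R) : t * (s * q) = t * s + t * s * (q - 1) by ring.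
by move=> K; rewrite E mulrDr mulr1 addrA lerD.
Qed.
End Rates.

Theorem theorem8p1 (R : realType) (V : completeNormedModType R)
    (dot : {dot V for (@idfun R)}) (hdot : induces_norm dot)
    (mu L r : R) (hmu : 0 <= mu) (hmuL : mu <= L) (hL : 0 < L)
    (f : V -> R^o) (hf : S1 dot mu L f)
    (xs : V) (hxs : forall z : V, f xs <= f z)
    (x y v : nat -> V) (alpha gamma rho : nat -> R)
    (hgamma0 : gamma 0%N = r * L) (hgamma0mu : mu <= gamma 0%N)
    (hgamma0_gt0 : 0 < gamma 0%N)
    (hy0 : y 0%N = x 0%N - L^-1 *: grad dot f (x 0%N))
    (halpha : forall k : nat, alpha k =
      (gamma k + Num.sqrt (gamma k ^+ 2 + 8%:R * L * gamma k)) / (2%:R * L))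
    (hx : forall k : nat,
      x k.+1 = (1 + alpha k)^-1 *: (y k + alpha k *: v k))
    (hy : forall k : nat,
      y k.+1 = x k.+1 - L^-1 *: grad dot f (x k.+1))
    (hv : forall k : nat, v k.+1 =
      (gamma k + mu * alpha k)^-1 *:
        (gamma k *: v k + (mu * alpha k) *: x k.+1)
      + (L * alpha k / (gamma k + mu * alpha k)) *: (y k.+1 - x k.+1))
    (hgamma : forall k : nat,
      gamma k.+1 = (gamma k + mu * alpha k) / (1 + alpha k))
    (hrho : forall k : nat, rho k = \prod_(i < k) (1 + alpha i)^-1) :
  let L0 := f (x 0%N) - f xs + gamma 0%N / 2%:R * `|v 0%N - xs| ^+ 2 in
  (forall k : nat,
     f (y k) - f xs + gamma k / 2%:R * `|v k - xs| ^+ 2 <= rho k * L0) /\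
  (forall k : nat,
     rho k <= Num.min
       ((Num.sqrt 2%:R / (Num.sqrt 2%:R + Num.sqrt r * k%:R)) ^+ 2)
       ((1 + Num.sqrt (2%:R * mu / L)) ^- k)).
Proof.
move=> L0; split=> k; last first.
  rewrite le_min (rho_quadratic hmu hL hgamma0_gt0 halpha hgamma hrho k hgamma0).
  by rewrite (rho_linear hmu hL hgamma0mu hgamma0_gt0 halpha hgamma hrho k).
pose E k : R := (f (x k) : R) - `|grad dot f (x k)| ^+ 2 / (2 * L) - f xs +
  gamma k / 2 * `|v k - xs| ^+ 2.
(* The initial [y] is also a gradient step, so index 0 needs no separate treatment. *)
have yE j : y j = x j - L^-1 *: grad dot f (x j) by case: j.
suff EL : E k <= rho k * L0.
  apply: le_trans EL; rewrite /E yE lerD2r lerD2r.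
  exact: (S1_gradient_step hdot hL hf).
have L0E : E 0%N <= L0.
  by rewrite /E /L0 lerD2r lerD2r gerBl divr_ge0 ?sqr_ge0// mulr_ge0// ltW.
elim: k => [|k IH]; first by rewrite hrho big_ord0 mul1r.
have g0 := gamma_gt0 hmu hL hgamma0_gt0 halpha hgamma k.
have [a0 aE] := alphaP hmu hL hgamma0_gt0 halpha hgamma k.
have a1 : 0 < 1 + alpha k by rewrite addr_gt0.
have c0 : gamma k + mu * alpha k != 0.
  by rewrite lt0r_neq0// ltr_pwDl// mulr_ge0// ltW.
rewrite (rhoS hrho) mulrAC ler_pdivlMr// mulrC (le_trans _ IH)//.
have xE : (1 + alpha k) *: x k.+1 =
    x k - L^-1 *: grad dot f (x k) + alpha k *: v k.
  by rewrite hx scalerA mulfV ?scale1r ?lt0r_neq0// yE.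
(* Since [y k.+1 - x k.+1] is the gradient times [- L^-1], the factor [L] cancels; the average is
   then recentred at [x k.+1]. *)
have vE : v k.+1 = x k.+1 + (gamma k + mu * alpha k)^-1 *:
    (gamma k *: (v k - x k.+1) - alpha k *: grad dot f (x k.+1)).
  move: (grad dot f (x k.+1)) (hy k) => g yk.
  transitivity ((gamma k + mu * alpha k)^-1 *: ((gamma k + mu * alpha k) *:
      x k.+1 + (gamma k *: (v k - x k.+1) - alpha k *: g))); last first.
    by rewrite scalerDr scalerK.
  rewrite hv yk (addrAC (x k.+1)) subrr add0r scalerN scalerA.
  rewrite mulrAC (mulrC L) mulfK ?lt0r_neq0// (mulrC (alpha k)) -(scalerA _ _ g).
  rewrite -scalerBr; congr (_ *: _); rewrite addrA; congr (_ - _).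
  by rewrite scalerDl scalerBr [RHS]addrC addrA subrK.
(* The factor [1 + alpha k] left by [rho] clears the denominator of [gamma k.+1]. *)
have cancel (a c n : R) : 0 < a -> a * (c / a / 2 * n) = c / 2 * n.
  by move=> /lt0r_neq0 ?; field.
rewrite /E mulrDr hgamma cancel//.
exact: (lyapunov_step hdot hL hf hmu xs a0 g0 aE xE vE).
Qed.
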